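(* Let $\mathcal{I}$ be a set of items, let $D$ be a timestamped transaction database over $\mathcal{I}$, let $W > 0$ be a window size, let $\sigma \in \mathbb{Z}_{>0}$ be a minimum support, and let $P \subseteq \mathcal{I}$ be an itemset. Let $\mathrm{cnt}$ be the occurrence count of $P$ within the window $[l, l+W]$, and suppose $\mathrm{cnt} \geq \sigma$. Let $t_{\mathrm{keep}}$ be the first of the last $\sigma$ occurrences of $P$ in this window. Then for any $l'$ satisfying $l \leq l' \leq t_{\mathrm{keep}}$, the window $[l', l'+W]$ is also a dense window of $P$. Therefore, advancing the window starting position $l$ to $t_{\mathrm{keep}} + 1$ does not miss any dense interval of $P$.
   Context: A timestamped transaction database over an item universe $\mathcal{I}$ is a finite set $D = \{(T_t, t) \mid t \in \mathbb{Z}_{\geq 0}\}$, where each $T_t \subseteq \mathcal{I}$ is the transaction corresponding to timestamp $t$. $T_{\max}$ denotes the maximum timestamp in $D$. An itemset is a subset $P \subseteq \mathcal{I}$. The occurrence timestamp sequence of $P$ is $\mathit{occ}(P) = \{t \mid P \subseteq T_t,\ (T_t, t) \in D\}$; its elements are the occurrences of $P$. The interval support (occurrence count) of $P$ in the window $[l, l+W]$ is $$\mathit{sup}(P, l, W) = |\{t \in \mathit{occ}(P) \mid l \leq t \leq l + W\}|,$$ so $\mathrm{cnt} = \mathit{sup}(P, l, W)$. If the occurrences in $[l, l+W]$ are ordered as $t_1 \leq t_2 \leq \cdots \leq t_{\mathrm{cnt}}$, then $t_{\mathrm{keep}} = t_{\mathrm{cnt}-\sigma+1}$. A window $[l, l+W]$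 is a dense window of $P$ if $\mathit{sup}(P, l, W) \geq \sigma$. An interval $[s,e]$ (with $0 \leq s$, $e \leq T_{\max}$ and $e - s \geq W$) is a dense interval of $P$ if $$\forall\, l \in \{t \in \mathit{occ}(P) \mid s \leq t \leq e - W\}:\ \mathit{sup}(P, l, W) \geq \sigma$$ and the interval cannot be further extended. The setting is a procedure that detects dense intervals of $P$ by moving a window $[l, l+W]$ to the right along the time axis; when the window at $l$ satisfies $\mathrm{cnt} \geq \sigma$, the procedure advances $l$ directly to $t_{\mathrm{keep}}+1$ (the ''stride-skip'') instead of examining every intermediate starting position. *)

(* Defs.v *)
From mathcomp Require Import all_boot finmap.
From mathcomp Require Import boolp classical_sets.

Set Implicit Arguments.
Unset Strict Implicit.
Unset Printing Implicit Defensive.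

(* The finite set {(T_t, t)} is a finite partial map from timestamps to
   transactions; the item universe I is an arbitrary, possibly infinite, type. *)
Definition database (I : Type) := {fmap nat -> set I}.

Section Database.

Context (I : Type) (D : database I).

(* T_max; the value on the empty database is the junk value 0. *)
Definition Tmax : nat := \max_(t <- domf D) t.

Definition occurs (P : set I) (t : nat) : bool :=
  if (D.[? t])%fmap is Some T then `[< (P `<=` T)%classic >] else false.

Definition occ (P : set I) : {fset nat} := [fset t in domf D | occurs P t]%fset.

Definition window_occ (P : set I) (l W : nat) : {fset nat} :=
  [fset t in occ P | (l <= t <= l + W)%N]%fset.

Definition sup (P : set I) (l W : nat) : nat := #|` window_occ P l W|.

(* This is t_(cnt - sigma + 1), occurrences being numbered from 1.
   Only meaningful when 0 < sigma <= sup P l W. *)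
Definition t_keep (P : set I) (l W sigma : nat) : nat :=
  nth 0 (sort leq (window_occ P l W)) (sup P l W - sigma).

Definition dense_window (P : set I) (W sigma l : nat) : Prop :=
  sigma <= sup P l W.

(* The bounds e - s >= W and t <= e - W are written additively because
   subtraction on nat is truncated. *)
Definition dense_on (P : set I) (W sigma s e : nat) : Prop :=
  [/\ e <= Tmax, s + W <= e &
      forall t, t \in occ P -> s <= t -> t + W <= e ->
        sigma <= sup P t W].

(* "Cannot be further extended": maximal for inclusion. *)
Definition dense_interval (P : set I) (W sigma s e : nat) : Prop :=
  dense_on P W sigma s e /\
  forall s' e', s' <= s -> e <= e' -> dense_on P W sigma s' e' ->
    s' = s /\ e' = e.

(* Moving the window start from l directly to m leaves the positions strictly
   between l and m unexamined.  The interval [s, e] is missed by this move if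
   an unexamined position p is the one where [s, e] begins (in particular if
   all window starts s, ..., e - W of [s, e] are unexamined), or the one where
   [s, e] is left, i.e. p = e - W + 1.  The latter position exists only if
   [p, p + W] still lies on the time axis, i.e. e < T_max. *)
Definition missed_by_advance (W l m s e : nat) : Prop :=
  exists2 p, l < p < m & p = s \/ (p + W = e.+1 /\ p + W <= Tmax).

End Database.

(* Main.v *)
(* The last sigma occurrences in [l, l + W] all lie in [l', l' + W] as soon as
   l <= l' <= t_keep.  If a dense interval began, or were left, at a skipped
   position p, the window at the bound crossed (p - 1, resp. p) would be dense,
   so the interval could be extended by one. *)
Require Import Defs.
From mathcomp Require Import all_boot finmap.
From mathcomp Require Import boolp classical_sets.

(** Meant for the sorted occurrences of a window, where entry [k] is [t_keep] and [drop k s] lists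
    the last [sigma] of them. *)
Lemma nth_sorted_le_drop (s : seq nat) (k x : nat) :
  sorted leq s -> x \in drop k s -> nth 0 s k <= x.
Proof.
move=> s_sorted /(nthP 0)[i]; rewrite size_drop ltn_subRL => lt_i <-.
rewrite nth_drop.
apply: (sorted_leq_nth leq_trans leqnn 0 s_sorted); rewrite ?leq_addr //.
by rewrite inE (leq_ltn_trans _ lt_i) ?leq_addr.
Qed.

Lemma mem_window_occ (I : Type) (D : database I) (P : set I) (l W t : nat) :
  (t \in window_occ D P l W) = (t \in occ D P) && (l <= t <= l + W).
Proof. by rewrite /window_occ !inE. Qed.

Lemma dense_window_t_keep (I : Type) (D : database I) (W sigma : nat)
    (P : set I) (l l' : nat) :
  sigma <= sup D P l W -> l <= l' <= t_keep D P l W sigma ->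
  dense_window D P W sigma l'.
Proof.
move=> hcnt /andP[le_ll' le_l'k]; rewrite /dense_window.
set s := sort leq (window_occ D P l W).
set last_sigma := drop (sup D P l W - sigma) s.
(* By [hcnt] the subtraction is not truncated. It remains to embed the duplicate-free list
   [last_sigma] in the window at [l']. *)
have <- : size last_sigma = sigma by rewrite size_drop size_sort subKn.
apply: uniq_leq_size => [|t t_last]; first by rewrite drop_uniq ?sort_uniq ?fset_uniq.
have : t \in window_occ D P l W by move: (mem_drop t_last); rewrite mem_sort.
rewrite !mem_window_occ => /and3P[-> _ le_t] /=; apply/andP; split.
  apply: (leq_trans le_l'k); apply: nth_sorted_le_drop t_last.
  exact: sort_sorted leq_total _.
by rewrite (leq_trans le_t) ?leq_add2r.
Qed.

Theorem proposition3 (I : Type) (D : database I) (W sigma : nat) (P : set I)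
    (l : nat) (hW : 0 < W) (hsigma : 0 < sigma)
    (hcnt : sigma <= sup D P l W) :
  (forall l' : nat, l <= l' <= t_keep D P l W sigma ->
     dense_window D P W sigma l') /\
  (forall s e : nat, dense_interval D P W sigma s e ->
     ~ missed_by_advance D W l (t_keep D P l W sigma).+1 s e).
Proof.
have dense l' : l <= l' <= t_keep D P l W sigma -> dense_window D P W sigma l'.
  exact: dense_window_t_keep.
split=> // s e [[le_eT le_sWe dense_se] maximal].
case=> p; rewrite ltnS => /andP[lt_lp le_pk] [p_s | [pW_e le_pWT]].
  (* Since [l < p], the start is a successor, called [s.+1] from here on; the larger interval is
     [[s, e]]. *)
  case: s p_s le_sWe dense_se maximal => [|s] p_s le_sWe dense_se maximal.
    by rewrite p_s in lt_lp.
  rewrite p_s in lt_lp le_pk.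
  have [|/n_Sn[]] := maximal s e (leqnSn s) (leqnn e).
  split=> // [|t t_occ]; first exact: ltnW.
  (* The only new window start is [s], and [l <= s < t_keep]. *)
  rewrite leq_eqVlt => /predU1P[<- _|]; last exact: dense_se.
  by apply: dense; rewrite -ltnS lt_lp ltnW.
(* Here [e.+1 = p + W <= Tmax] leaves room to extend to the right. *)
have [|_ /esym/n_Sn[]] := maximal s e.+1 (leqnn s) (leqnSn e).
split=> // [||t t_occ le_st]; first by rewrite -pW_e.
  exact: leqW.
(* The only new window start is [p], which is at most [t_keep]. *)
rewrite leq_eqVlt => /predU1P[tW_e|]; last exact: dense_se.
have -> : t = p by apply: (@addIn W); rewrite tW_e pW_e.
by apply: dense; rewrite le_pk ltnW.
Qed.
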